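(* Let $\epsilon>0$ and let $p\in(0,1)$ be such that $1/p$ is an integer. Suppose that $n=q^4+1$ where $q$ is a prime power and $p\,q^3(q^6+q^4+q^2+1)$ is an integer. Then, as $q\to\infty$, $$\frac{H_3(n,p,\epsilon)}{E(n,p)}\ge (1/p)^{\Theta(n^{1/4})}.$$
   Context: A 3-graph $G$ has a vertex set and an edge set consisting of 3-element subsets of the vertex set. An $n$-vertex 3-graph has density $p$ if it has exactly $p\binom{n}{3}$ edges. A Hamiltonian cycle of an $n$-vertex 3-graph $G$ is given by an ordering $v_1,\dots,v_n$ of its vertices such that for every $i$ the set $\{v_i,v_{i+1},v_{i+2}\}$ (indices modulo $n$) is an edge; the cycle is identified with this set of $n$ edges. $H(G)$ is the number of Hamiltonian cycles of $G$. For $\epsilon>0$, an $n$-vertex 3-graph $G$ is $(\epsilon,p)$-quasi random if its density is $p$ and for every $W\subset V(G)$ with $|W|=\lfloor n/2\rfloor$, the induced 3-graph $G[W]$ has density in $(p-\epsilon,p+\epsilon)$. $H_3(n,p,\epsilon)$ is the maximum of $H(G)$ over all $n$-vertex $(\epsilon,p)$-quasi random 3-graphs. $E(n,p)=p^n(n-1)!/2$. *)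

(* Defs.v *)
From HB Require Import structures.
From mathcomp Require Import all_boot all_order all_algebra all_fingroup.
From mathcomp Require Import reals exp.
Set Implicit Arguments. Unset Strict Implicit. Unset Printing Implicit Defensive.
Import Order.TTheory GRing.Theory Num.Theory.

Definition is_3graph (n : nat) (E : {set {set 'I_n}}) : bool :=
  [forall e in E, #|e| == 3].

Definition cycle_edges (n : nat) (s : {perm 'I_n}) : {set {set 'I_n}} :=
  [set [set s i; s (ordS i); s (ordS (ordS i))] | i : 'I_n].

(* H(G): number of Hamiltonian cycles, a cycle being identified with its
   edge set. *)
Definition ham_cycles (n : nat) (E : {set {set 'I_n}}) : {set {set {set 'I_n}}} :=
  [set C : {set {set 'I_n}} | [exists s : {perm 'I_n}, C == cycle_edges s]
                              && (C \subset E)].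
Definition H (n : nat) (E : {set {set 'I_n}}) : nat := #|ham_cycles E|.

Local Open Scope ring_scope.

Definition has_density (R : realType) (n : nat) (E : {set {set 'I_n}}) (p : R) : bool :=
  (#|E|%:R : R) == p * ('C(n, 3))%:R.

Definition quasi_random (R : realType) (n : nat) (eps p : R) (E : {set {set 'I_n}}) : bool :=
  has_density E p &&
  [forall W : {set 'I_n}, (#|W| == n./2) ==>
    (p - eps < (#|[set e in E | e \subset W]|%:R) / ('C(#|W|, 3))%:R < p + eps)].

(* H_3(n,p,eps): maximum of H(G) over (eps,p)-quasi random 3-graphs on n
   vertices (0 if there is none). *)
Definition H3 (R : realType) (n : nat) (p eps : R) : nat :=
  \max_(E : {set {set 'I_n}} | is_3graph E && quasi_random eps p E) H E.

Definition Eexp (R : realType) (n : nat) (p : R) : R :=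
  p ^+ n * ((n.-1)`!)%:R / 2.

Definition prime_power (q : nat) : Prop :=
  exists r k : nat, prime r /\ (0 < k)%N /\ q = (r ^ k)%N.

(* Main.v *)
(* Split the triples of 'I_n into blocks of L = 'C(q + 1, 3) triples, as many of
   them as possible being fans, i.e. sets of triples through a common pair of
   points; G is the union of a random p-fraction of the blocks.  A tight cycle
   survives with probability about p^d, where d is the number of blocks it meets.
   Two consecutive triples share a pair, so along a random ordering they lie in
   the same block with probability of order L / n, and by convexity the expected
   number of Hamiltonian cycles is at least about p^(n - c L) (n-1)!/2, far more
   than required (only the sizes of the blocks of a Steiner system S(3, q+1, q^4+1)
   matter, so none is needed).  A Chernoff bound, beating the union bound over
   all W, shows that the graphs that are not quasi-random contribute negligibly. *)
Require Import Defs.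
From HB Require Import structures.
From mathcomp Require Import all_boot all_order all_algebra all_fingroup.
From mathcomp Require Import reals sequences exp zify ring lra.
Set Implicit Arguments. Unset Strict Implicit. Unset Printing Implicit Defensive.
Import Order.TTheory GRing.Theory Num.Theory.

(** * Orderings and Hamiltonian cycles *)

Lemma val_ordS n (i : 'I_n) : ordS i = (if i.+1 == n then 0 else i.+1) :> nat.
Proof.
case: eqP => [/= ->|ne]; first exact: modnn.
by rewrite /= modn_small // ltn_neqAle ltn_ord andbT; apply/eqP.
Qed.

Lemma ordS_neq n (i : 'I_n) :
  3 < n -> [/\ ordS i != i, ordS (ordS i) != i & ordS (ordS (ordS i)) != i].
Proof.
move=> n4; have := ltn_ord i.
by split; apply/eqP => /(congr1 (@nat_of_ord n)); rewrite !val_ordS; do !case: eqP; lia.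
Qed.

Lemma ordS_inj n : injective (@ordS n).
Proof. exact: (can_inj (@ordSK n)). Qed.

Definition window n (s : {perm 'I_n}) (i : 'I_n) : {set 'I_n} :=
  [set s i; s (ordS i); s (ordS (ordS i))].

(* The pair (s (i+1), s (i+2)) lies in just two edges of the cycle of s, with
   third vertices s i and s (i+3). *)
Lemma cycle_edges_next n (s t : {perm 'I_n}) (i : 'I_n) :
  3 < n -> cycle_edges s = cycle_edges t ->
  s i = t i -> s (ordS i) = t (ordS i) ->
  s (ordS (ordS i)) = t (ordS (ordS i)) ->
  s (ordS (ordS (ordS i))) = t (ordS (ordS (ordS i))).
Proof.
move=> n4 eqst e0 e1 e2.
set i1 := ordS i; set i2 := ordS i1; set i3 := ordS i2.
have : window t i1 \in cycle_edges s by rewrite eqst; apply/imsetP; exists i1.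
case/imsetP=> j _; rewrite /window -/i2 -/i3 => eT.
have m1 : t i1 \in [set s j; s (ordS j); s (ordS (ordS j))].
  by rewrite -eT !inE eqxx.
have m2 : t i2 \in [set s j; s (ordS j); s (ordS (ordS j))].
  by rewrite -eT !inE eqxx orbT.
have m3 : t i3 \in [set s j; s (ordS j); s (ordS (ordS j))].
  by rewrite -eT !inE eqxx !orbT.
have [n10 n20 n30] := ordS_neq i n4.
have [n21 n31 _] := ordS_neq i1 n4.
have [n32 _ _] := ordS_neq i2 n4.
(* The window of [s] found here starts at [i1], at [i], or just before [i]. The first case gives the
   claim; in the second [t i3] would be one of [t i], [t i1], [t i2]; in the third the window would
   miss [s i2]. *)
move: m1; rewrite !inE -e1 !(inj_eq perm_inj) -orbA => /or3P[] /eqP ej.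
- move: m3; rewrite -ej !inE -/i1 -/i2 -/i3 e1 e2 !(inj_eq perm_inj).
  by rewrite (negPf n32) (negPf n31) /= => /eqP.
- move: m3; rewrite -(ordS_inj ej) !inE -/i1 -/i2 -/i3 e0 e1 e2 !(inj_eq perm_inj).
  by rewrite (negPf n32) (negPf n31) (negPf n30).
- have [a1 a2 a3] := ordS_neq j n4.
  have [b1 b2 _] := ordS_neq (ordS j) n4.
  have [c1 _ _] := ordS_neq (ordS (ordS j)) n4.
  move: m2; rewrite -e2 !inE !(inj_eq perm_inj) /i2 ej.
  by rewrite (negPf a3) (negPf b2) (negPf c1).
Qed.

Lemma iter_ordS n (o : 'I_n) m : val (iter m (@ordS n) o) = (o + m) %% n.
Proof.
elim: m => [|m IH] /=; first by rewrite addn0 modn_small.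
by rewrite IH -addn1 modnDml addn1 addnS.
Qed.

(** By [cycle_edges_next] an ordering is determined by its cycle and its values at three consecutive
    places. The polynomial loss is absorbed later by [gain_bound]. *)
Lemma card_ham_perms n (E : {set {set 'I_n}}) :
  3 < n -> #|[set s : {perm 'I_n} | cycle_edges s \subset E]| <= H E * n ^ 3.
Proof.
move=> n4; set A := [set s | _].
have o : 'I_n by exists 0; lia.
pose phi (s : {perm 'I_n}) :=
  (cycle_edges s, (s o, (s (ordS o), s (ordS (ordS o))))).
have phi_inj : injective phi.
  move=> s t [eC e0 e1 e2].
  have key m : [/\ s (iter m (@ordS n) o) = t (iter m (@ordS n) o),
    s (iter m.+1 (@ordS n) o) = t (iter m.+1 (@ordS n) o)
    & s (iter m.+2 (@ordS n) o) = t (iter m.+2 (@ordS n) o)].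
    elim: m => [//|m [h0 h1 h2]]; split=> //.
    exact: cycle_edges_next.
  apply/permP => i.
  have -> : i = iter (i + (n - o)) (@ordS n) o.
    apply: val_inj; rewrite iter_ordS; have := ltn_ord o; have := ltn_ord i.
    move=> hi ho; have -> : o + (i + (n - o)) = i + n by lia.
    by rewrite modnDr modn_small.
  by case: (key (i + (n - o))).
rewrite -(card_imset _ phi_inj).
have sub : phi @: A \subset setX (ham_cycles E) [set: 'I_n * ('I_n * 'I_n)].
  apply/subsetP => _ /imsetP[s sA ->]; rewrite !inE /= andbT.
  by move: sA; rewrite inE => ->; rewrite andbT; apply/existsP; exists s.
apply: leq_trans (subset_leq_card sub) _.
by rewrite cardsX cardsT !card_prod !card_ord /H !expnS expn0 muln1.
Qed.

Lemma ex_subset_card (T : finType) (A : {set T}) m :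
  m <= #|A| -> exists2 F : {set T}, F \subset A & #|F| = m.
Proof.
move=> mA; have : 0 < #|[set F : {set T} | F \subset A & #|F| == m]|.
  by rewrite cards_draws bin_gt0.
by case/card_gt0P=> F; rewrite inE => /andP[FA /eqP]; exists F.
Qed.

(* Greedily removes L-subsets satisfying Q as long as there are any; U is the
   part left over, which is then cut into L-subsets arbitrarily. *)
Lemma greedy_partition (T : finType) (Q : {set T} -> bool) (L B : nat)
    (V : {set T}) : 0 < L -> #|V| = B * L ->
  exists (blk : T -> nat) (U : {set T}),
  [/\ forall x, x \in V -> blk x < B,
      forall b, b < B -> #|[set x in V | blk x == b]| = L,
      forall F : {set T}, F \subset U -> #|F| = L -> ~~ Q F
    & forall x, x \in V -> x \notin U -> Q [set y in V | blk y == blk x]].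
Proof.
move=> L0; elim: B V => [|B IH] V cV.
  have V0 : V = set0 by apply/eqP; rewrite -cards_eq0 cV mul0n.
  exists (fun=> 0), set0; split=> [x|//|F|x]; rewrite ?V0 ?inE //.
  by rewrite subset0 => /eqP -> cF; rewrite -cF cards0 in L0.
have [F [FV cF hF]] : exists F : {set T}, [/\ F \subset V, #|F| = L
    & ~~ Q F -> forall F' : {set T}, F' \subset V -> #|F'| = L -> ~~ Q F'].
  have [/existsP[F /and3P[FV /eqP cF QF]]|noQ] :=
    boolP [exists F : {set T}, [&& F \subset V, #|F| == L & Q F]].
    by exists F; split=> //; rewrite QF.
  have [|F FV cF] := @ex_subset_card _ V L; first by rewrite cV mulSn leq_addr.
  exists F; split=> // _ F' F'V cF'; apply: contraNN noQ => QF'.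
  by apply/existsP; exists F'; rewrite F'V cF' eqxx.
have [|blk [U [hlt hcard hU hQ]]] := IH (V :\: F).
  by rewrite cardsDS // cV cF mulSn addKn.
pose blk' x := if x \in F then B else blk x.
have old b : b < B -> [set x in V | blk' x == b] = [set x in V :\: F | blk x == b].
  move=> bB; apply/setP => x; rewrite !inE /blk'.
  by case: (x \in F); rewrite //= gtn_eqF ?andbF.
have new : [set x in V | blk' x == B] = F.
  apply/setP => x; rewrite !inE /blk'; case: ifP => xF.
    by rewrite (subsetP FV) // eqxx.
  apply/negbTE/negP => /andP[xV /eqP e].
  by have := hlt x; rewrite !inE xF xV e ltnn => /(_ isT).
(* Once no set satisfying [Q] is left, all of [V] counts as leftover. *)
exists blk', (if Q F then U else V); split.
- move=> x xV; rewrite /blk'; case: ifP => // xF; apply: ltnW; rewrite ltnS.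
  by apply: hlt; rewrite !inE xF.
- move=> b; rewrite ltnS leq_eqVlt => /predU1P[->|bB]; first by rewrite new.
  by rewrite old // hcard.
- by case: ifP => [//|/negbT /hF].
move=> x xV; case: ifP => [QF xU|_ /negP //].
have [xF|xF] := boolP (x \in F); first by rewrite {2}/blk' xF new.
have xVF : x \in V :\: F by rewrite !inE xF.
by rewrite {2}/blk' (negPf xF) old ?hlt //; apply: hQ.
Qed.

(** * Consecutive triples in a common block *)

Lemma sum_mulperm n (t : {perm 'I_n}) (f : {perm 'I_n} -> nat) :
  \sum_s f (t * s)%g = \sum_s f s.
Proof. by rewrite [RHS](reindex_inj (mulgI t)). Qed.

(** Left multiplication by [tperm i j] is a bijection, so every [j] contributes equally. This stands
    in for resampling the vertex at place [i]. *)
Lemma sum_card_tperm n (P : pred {perm 'I_n}) (i : 'I_n) (J : {set 'I_n}) :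
  \sum_s #|[set j in J | P (tperm i j * s)%g]| = #|[set s | P s]| * #|J|.
Proof.
have e s : #|[set j in J | P (tperm i j * s)%g]| =
    \sum_(j in J) (if P (tperm i j * s)%g then 1 else 0).
  by rewrite -sum1dep_card -big_mkcondr.
under eq_bigr do rewrite e.
rewrite exchange_big /= -sum1dep_card [in RHS]big_mkcond mulnC -sum_nat_const.
apply: eq_bigr => j _.
exact: (sum_mulperm (tperm i j) (fun s => if P s then 1 else 0)).
Qed.

Lemma cards3 (T : finType) (a b c : T) :
  a != b -> a != c -> b != c -> #|[set a; b; c]| = 3.
Proof.
by move=> ab ac bc; rewrite -setUA !cardsU1 cards1 !inE negb_or ab ac bc.
Qed.

(** When [v] leaves [T], these are the vertices that continue a tight path without leaving the
    block. *)
Definition swaps n (J : eqType) (blk : {set 'I_n} -> J) (T : {set 'I_n}) (v : 'I_n) :=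
  [set w | (w \notin T) && (blk (w |: (T :\ v)) == blk T)].

(** With [T = {y, z, v}], any other triple of the block is [{y, z, w}] and arises by replacing [v],
    so the term for [v] alone already reaches [L.-1]. *)
Lemma card_pair_swaps n (J : eqType) (blk : {set 'I_n} -> J) (T : {set 'I_n})
    (y z : 'I_n) L :
  #|T| = 3 -> y != z ->
  #|[set T' : {set 'I_n} | (#|T'| == 3) && (blk T' == blk T)]| = L ->
  (forall T' : {set 'I_n}, #|T'| = 3 -> blk T' = blk T -> (y \in T') && (z \in T')) ->
  L.-1 <= \sum_(v in T) #|swaps blk T v|.
Proof.
move=> cT yz cL hfan; have /andP[yT zT] := hfan T cT erefl.
have rest (T' : {set 'I_n}) : #|T'| = 3 -> y \in T' -> z \in T' ->
    exists2 v, v \in T' & T' :\ v = [set y; z].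
  move=> cT' yT' zT'; have : #|T' :\ y :\ z| = 1.
    have := cardsD1 z (T' :\ y); have := cardsD1 y T'.
    by rewrite cT' yT' in_setD1 zT' eq_sym yz /= !add1n => -[<-] [<-].
  move=> /eqP/cards1P[v ev]; have : v \in T' :\ y :\ z by rewrite ev inE.
  rewrite !inE => /and3P[vz vy vT']; exists v => //.
  apply/setP => u; rewrite !inE; have /setP/(_ u) := ev; rewrite !inE.
  have [->|uz] := eqVneq u z; first by move=> _; rewrite eq_sym vz zT' orbT.
  have [->|uy] := eqVneq u y; first by move=> _; rewrite eq_sym vy yT'.
  by have [->|uv] := eqVneq u v => //= ->.
have [v vT eT] := rest T cT yT zT.
rewrite (bigD1 v) //=; apply: leq_trans (leq_addr _ _).
have TA : T \in [set T' : {set 'I_n} | (#|T'| == 3) && (blk T' == blk T)].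
  by rewrite inE cT !eqxx.
rewrite -cL (cardsD1 T) TA /=.
apply: leq_trans (leq_imset_card (fun w => w |: (T :\ v)) (swaps blk T v)).
apply/subset_leq_card/subsetP => T'; rewrite !inE => /and3P[T'T /eqP cT' /eqP bT'].
have /andP[yT' zT'] := hfan _ cT' bT'; have [w wT' eT'] := rest _ cT' yT' zT'.
have eW : T' = w |: (T :\ v) by rewrite eT -eT' setD1K.
apply/imsetP; exists w => //; rewrite inE -eW bT' eqxx andbT.
apply: contraNN T'T => wT; rewrite eqEcard cT cT' leqnn andbT eW.
by rewrite subUset sub1set wT subsetDl.
Qed.

Section Savings.
Variables (n L : nat) (J : finType) (blk : {set 'I_n} -> J) (U : {set {set 'I_n}}).

(* Only odd places are used: the block of a saved place is then also met at the
   preceding place, which is not saved. *)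
Definition saved (s : {perm 'I_n}) : {set 'I_n} :=
  [set i : 'I_n | odd i && (blk (window s (ord_pred i)) == blk (window s i))].

Definition blocks_hit (s : {perm 'I_n}) : {set J} :=
  [set blk (window s i) | i : 'I_n].

Lemma card_blocks_hit (s : {perm 'I_n}) : #|blocks_hit s| + #|saved s| <= n.
Proof.
have -> : blocks_hit s = [set blk (window s i) | i in ~: saved s].
  apply/setP => b; apply/imsetP/imsetP => -[i iS ->]; last by exists i.
  have [|si] := boolP (i \in saved s); last by exists i; rewrite ?in_setC.
  rewrite inE => /andP[oi /eqP e]; exists (ord_pred i); last by rewrite e.
  rewrite !inE negb_and; apply/orP; left.
  (* An odd place is nonzero, so its predecessor does not wrap around and is even, hence not
     saved. *)
  have i0 : 0 < i by case: (nat_of_ord i) oi.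
  have -> : ord_pred i = i.-1 :> nat.
    have := ltn_ord i; rewrite /= => hi.
    have -> : (i + n).-1 = i.-1 + n by lia.
    by rewrite modnDr modn_small //; lia.
  by rewrite -(prednK i0) /= in oi.
by rewrite -[leqRHS]card_ord -(cardsC (~: saved s)) setCK leq_add2r leq_imset_card.
Qed.

Hypothesis cardL : forall T : {set 'I_n}, #|T| = 3 ->
  #|[set T' : {set 'I_n} | (#|T'| == 3) && (blk T' == blk T)]| = L.
Hypothesis fan : forall T : {set 'I_n}, #|T| = 3 -> T \notin U ->
  exists y z, y != z /\ forall T' : {set 'I_n},
    #|T'| = 3 -> blk T' = blk T -> (y \in T') && (z \in T').
Hypothesis nofan : forall y z, y != z ->
  #|[set w | (w \notin [set y; z]) && ([set y; z; w] \in U)]| < L.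
Hypothesis Ln : 2 * L.-1 + 2 <= n.

(* Composing s with transpositions tperm i j averages over the vertex at place i:
   applied at i2 it bounds the chance that the triple is in U, at i3 it counts the
   possible continuations. *)
Lemma card_perms_blk (i0 i1 i2 i3 : 'I_n) :
  uniq [:: i0; i1; i2; i3] ->
  n`! * L.-1 <= 6 * n *
   #|[set s : {perm 'I_n} | blk [set s i0; s i1; s i2] == blk [set s i1; s i2; s i3]]|.
Proof.
rewrite /= !inE !negb_or !andbT => /andP[/and3P[n01 n02 n03] /andP[/andP[n12 n13] n23]].
have [n10 n20 n21] : [/\ i1 != i0, i2 != i0 & i2 != i1] by split; rewrite eq_sym.
have [n30 n31 n32] : [/\ i3 != i0, i3 != i1 & i3 != i2] by split; rewrite eq_sym.
set Z := #|_|; pose T s := [set (s : {perm 'I_n}) i0; s i1; s i2].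
have cT s : #|T s| = 3.
  by apply: cards3; rewrite (inj_eq perm_inj).
have n3 : 3 <= n by rewrite -(cards3 n01 n02 n12) -[leqRHS]card_ord max_card.
(* Given [s i0] and [s i1], fewer than [L] of the [n - 2] candidates for the third vertex put the
   triple in [U]; by [Ln] this is at most half of them. *)
have badU : 2 * #|[set s | T s \in U]| <= n`!.
  have := sum_card_tperm (fun s => T s \in U) i2 (~: [set i0; i1]).
  set b := #|_|; rewrite cardsCs setCK card_ord cards2 n01 /=.
  move=> e; have : b * (n - 2) <= n`! * L.-1.
    rewrite -e -card_Sn -sum_nat_const.
    apply: leq_sum => s _.
    have s01 : s i0 != s i1 by rewrite (inj_eq perm_inj).
    rewrite -ltnS prednK; last exact: leq_ltn_trans (nofan s01).
    apply: leq_ltn_trans (nofan s01).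
    rewrite -(card_imset _ (@perm_inj _ s)); apply/subset_leq_card/subsetP => _ /imsetP[j + ->].
    rewrite !inE !negb_or => /andP[/andP[j0 j1]].
    rewrite /T !permM tpermL !tpermD // => ->.
    by rewrite !(inj_eq perm_inj) j0 j1.
  move=> h; rewrite -(@leq_pmul2r (n - 2)) ?subn_gt0 // -mulnA.
  apply: leq_trans (leq_mul (leqnn 2) h) _.
  by rewrite mulnCA leq_mul2l leq_subRL ?(ltnW n3) // addnC Ln orbT.
have goodT : #|[set s | T s \notin U]| + #|[set s | T s \in U]| = n`!.
  rewrite -card_Sn -[RHS](cardsC [set s | T s \in U]) addnC; congr (_ + _).
  by apply: eq_card => s; rewrite !inE.
(* With the first three vertices kept, the candidates at place [i3] for which the two triples share
   a block are the swaps for [s i0]. *)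
have e0 : \sum_s #|swaps blk (T s) (s i0)| = Z * (n - 3).
  have := sum_card_tperm (fun s => blk [set s i0; s i1; s i2] == blk [set s i1; s i2; s i3])
    i3 (~: [set i0; i1; i2]).
  rewrite -/Z cardsCs setCK card_ord cards3 // => <-.
  apply: eq_bigr => s _; rewrite -[RHS](card_imset _ (@perm_inj _ s)).
  have rT j : s j |: T s :\ s i0 = [set s i1; s i2; s j].
    apply/setP => u; rewrite !inE; have [->|//] := eqVneq u (s i0).
    by rewrite !(inj_eq perm_inj) (negPf n01) (negPf n02) /= orbF.
    by move=> _; rewrite orbC -orbA.
  apply: eq_card => w; rewrite -[w](permKV s) (mem_imset _ _ perm_inj) !inE.
  set j := (s^-1)%g w. rewrite !(inj_eq perm_inj) rT !permM tpermL.
  have [->|j0] := eqVneq j i0 => //=; have [->|j1] := eqVneq j i1 => //=.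
  have [->|j2] := eqVneq j i2 => //=.
  by rewrite !tpermD // eq_sym.
(* [T s] is symmetric in its three places, so exchanging two of them gives the same total for
   [s i1], and likewise for [s i2]. *)
have e1 : \sum_s #|swaps blk (T s) (s i1)| = Z * (n - 3).
  rewrite -e0 -(sum_mulperm (tperm i0 i1)); apply: eq_bigr => s _.
  rewrite /T !permM tpermL tpermR tpermD //.
  by rewrite [s i1 |: _]setUC.
have e2 : \sum_s #|swaps blk (T s) (s i2)| = Z * (n - 3).
  rewrite -e0 -(sum_mulperm (tperm i0 i2)); apply: eq_bigr => s _.
  rewrite /T !permM tpermL tpermR tpermD //.
  by rewrite -setUA setUC [s i1 |: _]setUC.
have : #|[set s | T s \notin U]| * L.-1 <= 3 * (Z * (n - 3)).
  rewrite -sum_nat_const.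
  have -> : 3 * (Z * (n - 3)) = \sum_s \sum_(v in T s) #|swaps blk (T s) v|.
    rewrite !mulSn mul0n addn0 -{1}e0 -{1}e1 -e2 -!big_split; apply: eq_bigr => s _ /=.
    rewrite /T -setUA big_setU1 ?big_setU1 ?big_set1 //= !inE !(inj_eq perm_inj) //.
    by rewrite negb_or n01 n02.
  rewrite big_mkcond; apply: leq_sum => s _; case: ifP => //.
  rewrite inE => /(fan (cT s))[y [z [yz hf]]].
  exact: card_pair_swaps (cT s) yz (cardL (cT s)) hf.
(* At least half of the orderings have [T s] outside [U]; this 2 and the 3 choices of the removed
   vertex make the constant 6. *)
set a := #|_|; move: badU goodT; rewrite -/a; set b := #|_| => hb e.
rewrite -e mul2n -addnn leq_add2r in hb *; move: hb => ba hZ; move: e => _.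
have h1 : (a + b) * L.-1 <= 2 * (a * L.-1).
  by rewrite mulnA leq_mul2r mul2n -addnn leq_add2l ba orbT.
apply: leq_trans h1 _; apply: (leq_trans (leq_mul (leqnn 2) hZ)).
by rewrite mulnA -[2 * 3]/6 -mulnA [n * Z]mulnC !leq_mul2l leq_subr !orbT.
Qed.

(** There are at least [n / 3] odd places, and [card_perms_blk] applies to each with the constant 6,
    whence 18. *)
Lemma sum_card_saved : 4 <= n ->
  n`! * L.-1 <= 18 * \sum_s #|saved s|.
Proof.
move=> n4.
have -> : \sum_s #|saved s| = \sum_(i < n | odd i) #|[set s : {perm 'I_n} |
    blk (window s (ord_pred i)) == blk (window s i)]|.
  under eq_bigr => s _ do rewrite -sum1dep_card big_mkcondr /=.
  rewrite exchange_big /=; apply: eq_bigr => i _.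
  by rewrite -sum1dep_card [RHS]big_mkcond.
have n0 : 0 < 6 * n by rewrite muln_gt0 (leq_trans _ n4).
rewrite -(leq_pmul2l n0).
apply: (@leq_trans (18 * \sum_(i < n | odd i) n`! * L.-1)).
  rewrite -big_distrl /= sum_nat_const.
  have -> : #|[pred i : 'I_n | odd i]| = n./2.
    rewrite -sum1_card big_mkcond /= -(big_mkord predT (fun i => if odd i then 1 else 0)).
    elim: (n) => [|m IH]; first by rewrite big_geq.
    by rewrite big_nat_recr //= IH uphalf_half; case: odd; lia.
  by nia.
rewrite [leqRHS]mulnCA leq_mul2l /=.
rewrite big_distrr /=; apply: leq_sum => i _; rewrite -{2}[i]ord_predK.
have [a1 a2 a3] := ordS_neq (ord_pred i) n4.
have [b1 b2 _] := ordS_neq (ordS (ord_pred i)) n4.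
have [c1 _ _] := ordS_neq (ordS (ordS (ord_pred i))) n4.
apply: card_perms_blk; rewrite /= !inE !negb_or.
set j := ord_pred i in a1 a2 a3 b1 b2 c1 *.
rewrite (eq_sym j) a1 (eq_sym j) a2 (eq_sym j) a3.
rewrite (eq_sym (ordS j)) b1 (eq_sym (ordS j)) b2.
by rewrite eq_sym c1.
Qed.

End Savings.

(** * Binomial estimates *)

(** In the expansion of [(j + 1) ^ B], the terms [f i.+1] and [f i] compare as [B - i] and
    [j * i.+1], so the terms rise up to [M] and fall afterwards: the one at [M] is the largest of
    [B.+1]. *)
Lemma binomial_mode j M B : B = j.+1 * M ->
  j.+1 ^ B <= B.+1 * ('C(B, M) * j ^ (B - M)).
Proof.
move=> eB; pose f i := 'C(B, i) * j ^ (B - i).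
have MB : M <= B by rewrite eB leq_pmull.
have step i : i < B -> i.+1 * f i.+1 = (B - i) * ('C(B, i) * j ^ (B - i.+1)) /\
    f i = j * ('C(B, i) * j ^ (B - i.+1)).
  move=> iB; rewrite /f mulnA mul_bin_left mulnA; split=> //.
  by rewrite -[in LHS]subSS subSn // expnS mulnCA.
have up d : d <= M -> f (M - d) <= f M.
  elim: d => [|d IH] dM; first by rewrite subn0.
  apply: leq_trans (IH (ltnW dM)).
  have -> : M - d = (M - d.+1).+1 by lia.
  set i := M - d.+1; have iM : i < M by rewrite /i; lia.
  rewrite -(@leq_pmul2l i.+1) //.
  have [|-> ->] := step i; first exact: leq_trans MB.
  rewrite mulnA leq_mul2r; apply/orP; right.
  by rewrite eB; nia.
have down d : M + d <= B -> f (M + d) <= f M.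
  elim: d => [|d IH] dM; first by rewrite addn0.
  apply: (leq_trans _ (IH _)); last by lia.
  rewrite addnS -(@leq_pmul2l (M + d).+1) //.
  have [|-> ->] := step (M + d); first by lia.
  rewrite [leqRHS]mulnA leq_mul2r; apply/orP; right.
  by rewrite eB; nia.
have -> : j.+1 ^ B = \sum_(i < B.+1) f i.
  rewrite -addn1 expnDn; apply: eq_bigr => i _.
  by rewrite exp1n muln1.
rewrite -[X in X * _]card_ord -sum_nat_const; apply: leq_sum => i _.
have [iM|Mi] := leqP i M; first by rewrite -(subKn iM) up // leq_subr.
by rewrite -(subnKC (ltnW Mi)) down // (subnKC (ltnW Mi)) -ltnS.
Qed.

(** Adjoining [D] is injective on subsets of its complement. *)
Lemma card_supersets (I : finType) (D : {set I}) M : #|D| <= M ->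
  'C(#|I| - #|D|, M - #|D|) <=
    #|[set S : {set I} | (#|S| == M) && (D \subset S)]|.
Proof.
move=> dM; have -> : #|I| - #|D| = #|~: D| by rewrite [RHS]cardsCs setCK.
rewrite -cards_draws.
rewrite -(@card_in_imset _ _ (fun S => D :|: S)); last first.
  move=> S S'; rewrite !inE => /andP[S1 _] /andP[S2 _] e.
  have h (X : {set I}) : X \subset ~: D -> (D :|: X) :\: D = X.
    by move=> XD; rewrite setDUl setDv set0U; apply/setDidPl; rewrite disjoints_subset.
  by rewrite -(h _ S1) e h.
apply/subset_leq_card/subsetP => _ /imsetP[S + ->].
rewrite !inE subsetUl andbT => /andP[SD /eqP cS].
have /setDidPl hd : [disjoint S & D] by rewrite disjoints_subset.
rewrite cardsU; have -> : D :&: S = set0.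
  by apply/eqP; rewrite setIC setI_eq0 disjoints_subset.
by rewrite cards0 subn0 cS subnKC.
Qed.

(** Greedy removal with fans as the preferred sets: [L] leftover triples through one pair would form
    a further fan. *)
Lemma exists_triple_blocks (n B L : nat) :
  0 < L -> 0 < B -> 'C(n, 3) = B * L ->
  exists (blk : {set 'I_n} -> 'I_B) (U : {set {set 'I_n}}),
  [/\ forall b, #|[set T : {set 'I_n} | (#|T| == 3) && (blk T == b)]| = L,
      forall T : {set 'I_n}, #|T| = 3 -> T \notin U ->
        exists y z, y != z /\ forall T' : {set 'I_n},
          #|T'| = 3 -> blk T' = blk T -> (y \in T') && (z \in T')
    & forall y z, y != z ->
        #|[set w | (w \notin [set y; z]) && ([set y; z; w] \in U)]| < L].
Proof.
move=> L0 B0 cn; pose V : {set {set 'I_n}} := [set T : {set 'I_n} | #|T| == 3].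
have cV : #|V| = B * L by rewrite card_draws card_ord.
pose fan (F : {set {set 'I_n}}) :=
  [exists y, exists z, (y != z) && [forall T in F, (y \in T) && (z \in T)]].
have [blk [U [hlt hcard hU hQ]]] := greedy_partition fan L0 cV.
(* Labels of non-triples may be out of range; those are sent to block 0, and only triples are ever
   counted. *)
pose bl (T : {set 'I_n}) : 'I_B := insubd (Ordinal B0) (blk T).
have blE (T : {set 'I_n}) : #|T| = 3 -> bl T = blk T :> nat.
  by move=> cT; rewrite val_insubd hlt // inE cT.
exists bl, U; split=> [b|T cT TU|y z yz].
- rewrite -(hcard _ (ltn_ord b)); apply: eq_card => T; rewrite !inE.
  by case: eqP => //= cT; rewrite -val_eqE /= blE.
- have /existsP[y /existsP[z /andP[yz /forall_inP h]]] : fan [set T' in V | blk T' == blk T].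
    by apply: hQ; rewrite // inE cT.
  exists y, z; split=> // T' cT' e; apply: h.
  by rewrite !inE cT' eqxx -!blE // e /=.
rewrite ltnNge; apply/negP => hL.
set X := [set w | _] in hL.
have inj : {in X &, injective (fun w => [set y; z; w])}.
  move=> w w'; rewrite !inE => /andP[/norP[wy wz] _] _ /setP/(_ w).
  by rewrite !inE eqxx orbT (negPf wy) (negPf wz) => /esym/eqP.
rewrite -(card_in_imset inj) in hL.
have [F FX cF] := ex_subset_card hL.
have /negP[] : ~~ fan F.
  apply: hU => //; apply: subset_trans FX _; apply/subsetP => _ /imsetP[w + ->].
  by rewrite inE => /andP[].
apply/existsP; exists y; apply/existsP; exists z; rewrite yz /=.
apply/forall_inP => T /(subsetP FX)/imsetP[w _ ->].
by rewrite !inE !eqxx orbT.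
Qed.

(** * Numerical estimates in terms of [q] *)

Lemma bin3 m : 6 * 'C(m, 3) = m * (m - 1) * (m - 2).
Proof.
rewrite mulnC -[6]/(3`!) bin_ffact ffactnS ffactnS ffactn1.
by case: m => [|[|m]] //=; rewrite !subSS !subn0 mulnA.
Qed.

Lemma bin_le_exp2 n m : 'C(n, m) <= 2 ^ n.
Proof.
have <- : #|{set 'I_n}| = 2 ^ n.
  by rewrite -cardsT -powersetT card_powerset cardsT card_ord.
by rewrite -[X in 'C(X, _)](card_ord n) -card_draws max_card.
Qed.

(** The quotient is [q^3 (q^4 + 1) (q^2 + 1)], the number of blocks of a Steiner system S(3, q+1,
    q^4+1). *)
Lemma design_count q : 0 < q ->
  'C(q ^ 4 + 1, 3) = q ^ 3 * (q ^ 6 + q ^ 4 + q ^ 2 + 1) * 'C(q + 1, 3).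
Proof.
move=> q0; apply/eqP; rewrite -(@eqn_pmul2l 6) // mulnCA !bin3 !addnK.
have -> : q ^ 4 + 1 - 2 = q ^ 4 - 1 by lia.
have -> : q + 1 - 2 = q - 1 by lia.
have -> : q ^ 4 - 1 = (q ^ 3 + q ^ 2 + q + 1) * (q - 1).
  by case: q q0 => // q _; rewrite subn1 /=; nia.
by apply/eqP; ring.
Qed.

(** The first bound serves to save [11 * q] places through [sum_card_saved], the second feeds
    [half_triples_bound], the third gives [Ln]. *)
Lemma block_size_bounds q : 40 <= q ->
  [/\ 198 * q < 'C(q + 1, 3), 6 * 'C(q + 1, 3) <= q ^ 3 & 2 * 'C(q + 1, 3) <= q ^ 4].
Proof.
move=> q40; have := bin3 (q + 1); rewrite addnK.
have -> : q + 1 - 2 = q - 1 by lia.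
set L := 'C(_, _) => e.
have h3 : 6 * L <= q ^ 3.
  rewrite e; case: q q40 {e L} => // q _; rewrite subn1 /= !expnS expn0; nia.
have h4 : q ^ 3 <= q ^ 4 by rewrite leq_exp2l //; lia.
split=> //; last by lia.
have : 40 * (39 * q) <= 6 * L.
  rewrite e; case: q q40 {e L h3 h4} => // q q40; rewrite subn1 /=; nia.
by lia.
Qed.

(** For [h] half of the vertices, each of [h], [h - 1], [h - 2] is at least [q^4 / 4]. *)
Lemma half_triples_bound q : 4 <= q ->
  q ^ 9 * (6 * 'C(q + 1, 3)) <= q ^ 12 ->
  q ^ 9 * 'C(q + 1, 3) <= 64 * 'C((q ^ 4 + 1)./2, 3).
Proof.
move=> q4 hL; have := bin3 (q ^ 4 + 1)./2; set h := _./2 => eA.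
have hh : q ^ 4 <= 2 * h.
  by have := odd_double_half (q ^ 4 + 1); rewrite -/h; case: odd; lia.
have q8 : 16 <= q ^ 4 by rewrite (@leq_trans (4 ^ 4)) ?leq_exp2r.
have b2 : q ^ 4 <= 4 * (h - 2) by lia.
have b1 : q ^ 4 <= 4 * (h - 1) by lia.
have b0 : q ^ 4 <= 4 * h by lia.
have : q ^ 4 * q ^ 4 * q ^ 4 <= 4 * h * (4 * (h - 1)) * (4 * (h - 2)).
  by do 2?apply: leq_mul => //.
have -> : 4 * h * (4 * (h - 1)) * (4 * (h - 2)) = 64 * (6 * 'C(h, 3)).
  by rewrite eA; ring.
by rewrite -!expnD; lia.
Qed.

(** The slack [k ^ (9 * q)] absorbs the polynomial factor: [2 ^ (8 * q)] exceeds [q ^ 8], and the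
    remaining [2 ^ q] covers the constant 16. *)
Lemma gain_bound (k q : nat) : 2 <= k -> 40 <= q ->
  4 * (q ^ 4 + 1) ^ 2 * k ^ (2 * q) <= k ^ (11 * q).
Proof.
move=> k2 q40.
have -> : (11 * q = 9 * q + 2 * q) by lia.
rewrite expnD leq_mul2r; apply/orP; right.
apply: (@leq_trans (2 ^ (9 * q))); last by rewrite leq_exp2r //; lia.
have hq : (q ^ 8 <= 2 ^ (8 * q)).
  by rewrite mulnC expnM leq_exp2r // ltnW // ltn_expl.
have hn : (q ^ 4 + 1 <= 2 * q ^ 4) by have := expn_gt0 q 4; lia.
apply: (@leq_trans (4 * (2 * q ^ 4) ^ 2)); first by rewrite leq_mul2l leq_sqr hn.
have -> : (4 * (2 * q ^ 4) ^ 2 = 2 ^ 4 * q ^ 8) by ring.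
apply: leq_trans (leq_mul (leqnn _) hq) _.
by rewrite -expnD leq_exp2l //; lia.
Qed.

(** * Random subsets of fixed size: containment and tail bounds *)

Local Open Scope ring_scope.

(** This bounds the chance that a random [M]-subset of [k * M] points contains [d] given ones. One
    more point costs [(M - d) / (k M - d) >= (1 - d / M) / k], and [(1 - d / M) (1 - d^2 / M) >= 1 -
    (d + 1)^2 / M]. *)
Lemma bin_ratio (R : realFieldType) k M d : (0 < k)%N -> (0 < M)%N -> (d <= M)%N ->
  'C(k * M, M)%:R * k%:R^-1 ^+ d * (1 - d%:R ^+ 2 / M%:R) <=
  'C(k * M - d, M - d)%:R :> R.
Proof.
move=> k0 M0; elim: d => [|d IH] dM.
  by rewrite !subn0 expr0 expr0n /= mul0r subr0 !mulr1.
have {}IH := IH (ltnW dM).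
have rec := mul_bin_diag (k * M - d) (M - d.+1).
rewrite -subnS in rec.
have e1 : (M - d.+1).+1 = (M - d)%N by lia.
rewrite e1 in rec; move: rec IH.
set X := 'C(k * M - d, M - d); set Y := 'C(_, M - d.+1); set Z := 'C(k * M, M).
move=> rec IH.
have k0R : 0 < k%:R :> R by rewrite ltr0n.
have M0R : 0 < M%:R :> R by rewrite ltr0n.
have dMR : d.+1%:R <= M%:R :> R by rewrite ler_nat.
have rec1 : (M%:R - d%:R) * X%:R <= k%:R * M%:R * Y%:R :> R.
  rewrite -natrB; last exact: ltnW.
  by rewrite -!natrM ler_nat -rec leq_mul2r leq_subr orbT.
set y : R := M%:R^-1 in IH *; set p : R := k%:R^-1 in IH *.
have y0 : 0 < y by rewrite invr_gt0.
have p0 : 0 < p by rewrite invr_gt0.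
have My : M%:R * y = 1 by rewrite mulfV // lt0r_neq0.
have kp : k%:R * p = 1 by rewrite mulfV // lt0r_neq0.
have dy : d.+1%:R * y <= 1 by rewrite -[leRHS]My ler_wpM2r // ltW.
have step : p * (1 - d%:R * y) * X%:R <= Y%:R.
  have -> : (Y%:R : R) = p * y * (k%:R * M%:R * Y%:R).
    by have -> : p * y * (k%:R * M%:R * Y%:R) = (M%:R * y) * (k%:R * p) * Y%:R;
       [ring | rewrite My kp !mul1r].
  have -> : p * (1 - d%:R * y) * X%:R = p * y * ((M%:R - d%:R) * X%:R).
    by have -> : p * y * ((M%:R - d%:R) * X%:R) = p * (M%:R * y - d%:R * y) * X%:R;
       [ring | rewrite My].
  by rewrite ler_wpM2l // mulr_ge0 // ltW.
apply: le_trans step.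
rewrite -natr1 in dy *.
have d0 : 0 <= d%:R :> R by rewrite ler0n.
have hd : 0 <= 1 - d%:R * y by lra.
have h1 : p * (1 - d%:R * y) * (Z%:R * p ^+ d * (1 - d%:R ^+ 2 * y)) <=
    p * (1 - d%:R * y) * X%:R.
  by rewrite ler_wpM2l // mulr_ge0 // ltW.
apply: le_trans h1; rewrite exprS.
have c0 : 0 <= Z%:R * (p * p ^+ d) by rewrite mulr_ge0 ?ler0n // -exprS exprn_ge0 // ltW.
have -> : p * (1 - d%:R * y) * (Z%:R * p ^+ d * (1 - d%:R ^+ 2 * y)) =
   Z%:R * (p * p ^+ d) * ((1 - d%:R * y) * (1 - d%:R ^+ 2 * y)) by ring.
rewrite ler_wpM2l //.
have dy0 : 0 <= d%:R * y by rewrite mulr_ge0 // ltW.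
have ddy0 : 0 <= d%:R * d%:R * (d%:R * y) * y by rewrite !mulr_ge0 // ltW.
by rewrite !expr2; nra.
Qed.

(* Tangent line of x |-> p^x at m, used in place of Jensen's inequality. *)
Lemma bernoulli_tangent (R : realDomainType) (p : R) (d m : nat) : 0 <= p <= 1 ->
  p ^+ m * (1 + (m%:R - d%:R) * (1 - p)) <= p ^+ d.
Proof.
move=> /andP[p0 p1]; have [dm|/ltnW md] := leqP d m.
  rewrite -natrB // -{1}(subnK dm); move: (m - d)%N => e.
  rewrite exprD -mulrA mulrCA -[leRHS]mulr1 ler_wpM2l ?exprn_ge0 //.
  elim: e => [|e IH]; first by rewrite expr0 mul0r addr0 mulr1.
  apply: le_trans IH; rewrite exprSr -mulrA ler_wpM2l ?exprn_ge0 //.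
  rewrite -natr1; have : 0 <= e%:R :> R by rewrite ler0n.
  have := sqr_ge0 (1 - p); rewrite expr2; set z := _ * _ => z0 e0.
  have : 0 <= e%:R * z by rewrite mulr_ge0.
  by rewrite /z; nra.
rewrite -{2}(subnKC md) exprD ler_wpM2l ?exprn_ge0 // -opprB -natrB // mulNr.
move: (d - m)%N => e; elim: e => [|e IH]; first by rewrite expr0 mul0r subr0.
rewrite exprS -natr1; apply: le_trans (ler_wpM2l p0 IH).
have := sqr_ge0 (1 - p); rewrite expr2; set z := _ * _ => z0.
have : 0 <= e%:R * z by rewrite mulr_ge0 // ler0n.
by rewrite /z; nra.
Qed.

(* Drop the size condition, weighting the indices outside S by j; the ratio
   (j+1)^B / ('C(B, M) j^(B - M)) lost is at most B + 1, since M is the mode. *)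
Lemma sum_subsets_le (R : numFieldType) (I : finType) (j M : nat) (x : I -> R) :
  (0 < j)%N -> #|I| = (j.+1 * M)%N -> (forall i, 0 <= x i) ->
  \sum_(S : {set I} | #|S| == M) \prod_(i in S) x i <=
  (#|I|.+1 * 'C(#|I|, M))%:R * \prod_i (1 + j.+1%:R^-1 * (x i - 1)).
Proof.
move=> j0 cI x0; pose J : R := j%:R; pose B := #|I|.
have J0 : 0 < J by rewrite ltr0n.
have jB : 0 < J ^+ (B - M) by rewrite exprn_gt0.
rewrite -(ler_pM2r jB) mulr_suml.
(* Each factor equals [(x i + j) / (j + 1)]; expanding the product over all subsets gives the weight
   [j] to each index outside [S]. *)
have -> : \prod_i (1 + j.+1%:R^-1 * (x i - 1)) = j.+1%:R^-1 ^+ B * \prod_i (x i + J).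
  rewrite -prodr_const -big_split; apply: eq_bigr => i _ /=.
  have jj : j.+1%:R = J + 1 by rewrite natr1.
  have : j.+1%:R != 0 :> R by rewrite pnatr_eq0.
  by rewrite jj => h; field.
rewrite bigA_distr /=.
apply: (@le_trans _ _ (\sum_(S : {set I}) \prod_i (if i \in S then x i else J))).
  rewrite [leRHS](bigID (fun S : {set I} => #|S| == M)) /=.
  apply: ler_wpDr.
    apply: sumr_ge0 => S _; apply: prodr_ge0 => i _; case: ifP => // _; exact: ltW.
  apply: ler_sum => S /eqP cS; rewrite [leRHS](bigID (mem S)) /=.
  rewrite [X in _ <= X * _](eq_bigr x); last by move=> i ->.
  rewrite [X in _ <= _ * X](eq_bigr (fun=> J)); last by move=> i /negbTE ->.
  have -> : \prod_(i in predC (mem S)) J = J ^+ (B - M).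
    by rewrite prodr_const /B -(cardC (mem S)) cS addKn.
  by [].
set P := \sum_(S : {set I}) _.
have P0 : 0 <= P.
  by apply: sumr_ge0 => S _; apply: prodr_ge0 => i _; case: ifP => // _; exact: ltW.
set N := (_ * _)%N; rewrite [N%:R * _]mulrA mulrAC -[leLHS]mul1r ler_wpM2r //.
rewrite exprVn mulrAC ler_pdivlMr ?exprn_gt0 ?ltr0n // mul1r.
rewrite /J -!natrX -natrM ler_nat /N -mulnA.
exact: binomial_mode cI.
Qed.

(** From [exp x <= 1 / (1 - x)], since [(1 - x) (1 + x + 2 x^2) = 1 + x^2 (1 - 2 x)]. *)
Lemma expR_le_quadratic (R : realType) (x : R) :
  x <= 1 / 2 -> expR x <= 1 + x + 2 * x ^+ 2.
Proof.
move=> hx; have h := expR_ge1Dx (- x).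
have e : expR (- x) * expR x = 1 by rewrite -expRD addNr expR0.
have ex0 := expR_gt0 x.
have h1 : (1 - x) * expR x <= 1 by rewrite -[leRHS]e ler_wpM2r // ltW.
have x1 : 0 < 1 - x by lra.
rewrite -(ler_pM2l x1); apply: (le_trans h1).
have : 0 <= x ^+ 2 * (1 - 2 * x) by rewrite mulr_ge0 ?sqr_ge0 //; lra.
by rewrite !expr2; nra.
Qed.

(** Markov's inequality for the exponential moment: [sum_subsets_le] decouples the indices as if
    each were chosen independently with probability [1 / (j + 1)], and each factor is bounded by
    [1 + y <= exp y]. *)
Lemma chernoff_subsets (R : realType) (I : finType) (j M : nat) (a : I -> R) (t : R) :
  (0 < j)%N -> #|I| = (j.+1 * M)%N -> (forall i, a i <= 1 / 2) ->
  #|[set S : {set I} | (#|S| == M) && (t <= \sum_(i in S) a i)]|%:R <=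
  (#|I|.+1 * 'C(#|I|, M))%:R *
    expR (j.+1%:R^-1 * (\sum_i a i + 2 * \sum_i a i ^+ 2) - t).
Proof.
move=> j0 cI ha; set p := j.+1%:R^-1.
have p0 : 0 <= p by rewrite invr_ge0 ler0n.
rewrite expRD expRN mulrA ler_pdivlMr ?expR_gt0 // [leLHS]mulr_natl -sumr_const.
apply: (@le_trans _ _ (\sum_(S : {set I} | #|S| == M) \prod_(i in S) expR (a i))).
  rewrite big_mkcond [leRHS]big_mkcond. apply: ler_sum => S _; rewrite inE.
  case: (#|S| == M) => //=; rewrite -expR_sum; case: ifP => h; last exact: expR_ge0.
  by rewrite ler_expR.
apply: le_trans (sum_subsets_le j0 cI _) _ => [i|]; first exact: expR_ge0.
rewrite -/p ler_wpM2l ?ler0n // mulr_sumr -big_split mulr_sumr expR_sum /=.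
apply: ler_prod => i _; apply/andP; split.
  have := expR_gt0 (a i); have : p <= 1 by rewrite invf_le1 ?ltr0n // ler1n.
  move=> p1 e0; have := mulr_ge0 p0 (ltW e0); rewrite mulrBr mulr1; lra.
apply: le_trans (expR_ge1Dx _); rewrite lerD2l ler_wpM2l //.
by have := expR_le_quadratic (ha i); lra.
Qed.

(** * Random unions of blocks *)

Section RandomBlocks.
Variables (R : realType) (n L j M : nat) (J : finType) (blk : {set 'I_n} -> J).
Hypothesis cardL : forall b,
  #|[set T : {set 'I_n} | (#|T| == 3) && (blk T == b)]| = L.
Hypothesis cardJ : #|J| = (j.+1 * M)%N.
Hypotheses (j0 : (0 < j)%N) (L0 : (0 < L)%N) (M0 : (0 < M)%N).

Definition block_union (S : {set J}) : {set {set 'I_n}} :=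
  [set T : {set 'I_n} | (#|T| == 3) && (blk T \in S)].

Lemma sum_card_fibers (P : pred {set 'I_n}) (S : {set J}) :
  #|[set T in block_union S | P T]| =
  (\sum_(b in S) #|[set T : {set 'I_n} | [&& #|T| == 3, blk T == b & P T]]|)%N.
Proof.
rewrite -sum1_card (partition_big blk (mem S)) /=; last first.
  by move=> T; rewrite !inE => /andP[/andP[]].
apply: eq_bigr => b bS; rewrite -sum1_card; apply: eq_bigl => T; rewrite !inE.
by have [->|_] := eqVneq (blk T) b; rewrite ?bS ?andbT ?andbF ?andbT .
Qed.

Lemma card_block_union S : #|block_union S| = (#|S| * L)%N.
Proof.
rewrite -sum_nat_const.
have -> : block_union S = [set T in block_union S | predT T].
  by apply/setP => T; rewrite !inE andbT.
rewrite sum_card_fibers; apply: eq_bigr => b _; rewrite -(cardL b).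
by apply: eq_card => T; rewrite !inE andbT.
Qed.

Definition edges_in (S : {set J}) (W : {set 'I_n}) :=
  #|[set e in block_union S | e \subset W]|.

Definition deviates (eps : R) (S : {set J}) (W : {set 'I_n}) : bool :=
  ~~ (j.+1%:R^-1 - eps < (edges_in S W)%:R / 'C(#|W|, 3)%:R < j.+1%:R^-1 + eps).

(** Chernoff for both tails of [edges_in S W], a sum over the chosen blocks of weights [c b] that
    lie in [[0, L]] and total [A], so that their squares total at most [L A]. *)
Lemma card_deviates (eps : R) (W : {set 'I_n}) :
  0 < eps <= 1 -> (0 < 'C(#|W|, 3))%N ->
  #|[set S : {set J} | (#|S| == M) && deviates eps S W]|%:R <=
  2 * (#|J|.+1 * 'C(#|J|, M))%:R * expR (- (eps ^+ 2 / 8 * ('C(#|W|, 3)%:R / L%:R))).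
Proof.
move=> /andP[e0 e1] A0; set A : R := 'C(#|W|, 3)%:R; set p : R := j.+1%:R^-1.
pose c b : R := #|[set T : {set 'I_n} | [&& #|T| == 3, blk T == b & T \subset W]]|%:R.
have edgesE S : (edges_in S W)%:R = \sum_(b in S) c b.
  by rewrite /edges_in (sum_card_fibers (fun T => T \subset W)) natr_sum.
have sumc : \sum_b c b = A.
  transitivity (\sum_(b in [set: J]) c b).
    by apply: eq_bigl => b; rewrite inE.
  rewrite -edgesE /edges_in /A -cards_draws; congr _%:R.
  by apply: eq_card => T; rewrite !inE andbT andbC.
have c0 b : 0 <= c b by rewrite ler0n.
have cL b : c b <= L%:R.
  rewrite ler_nat -(cardL b); apply/subset_leq_card/subsetP => T.
  by rewrite !inE => /and3P[-> ->].
have LR : 0 < L%:R :> R by rewrite ltr0n.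
have AR : 0 < A by rewrite ltr0n.
have p0 : 0 < p by rewrite invr_gt0 ltr0n.
have p1 : p <= 1 by rewrite invf_le1 ?ltr0n // ler1n.
(* This scale keeps the exponents below 1/2 and the quadratic term at most half of the linear gain
   [l * eps * A]. *)
pose l : R := eps / 4 / L%:R.
have lL : l * L%:R = eps / 4 by rewrite /l mulfVK // lt0r_neq0.
have l0 : 0 < l by rewrite !divr_gt0.
have sumc2 : \sum_b c b ^+ 2 <= L%:R * A.
  rewrite -sumc mulr_sumr; apply: ler_sum => b _.
  by rewrite expr2 ler_wpM2r.
have expo : p * (2 * (l ^+ 2 * (L%:R * A))) - l * eps * A <=
    - (eps ^+ 2 / 8 * (A / L%:R)).
  have -> : eps ^+ 2 / 8 * (A / L%:R) = l * eps * A / 2.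
    by rewrite /l; field; rewrite lt0r_neq0.
  have -> : p * (2 * (l ^+ 2 * (L%:R * A))) = p * (l * eps * A) / 2.
    have -> : p * (2 * (l ^+ 2 * (L%:R * A))) = p * (2 * (l * A * (l * L%:R))) by ring.
    by rewrite lL; field.
  have : p * (l * eps * A) <= 1 * (l * eps * A).
    by apply: ler_wpM2r => //; exact: ltW (mulr_gt0 (mulr_gt0 l0 e0) AR).
  by lra.
have bound (sg : R) : sg ^+ 2 = 1 ->
  #|[set S : {set J} | (#|S| == M) &&
     (sg * l * p * A + l * eps * A <= \sum_(b in S) (sg * l * c b))]|%:R <=
   (#|J|.+1 * 'C(#|J|, M))%:R * expR (- (eps ^+ 2 / 8 * (A / L%:R))).
  move=> sg2; apply: le_trans (chernoff_subsets _ j0 cardJ _) _ => [b|].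
    have sg1 : sg <= 1.
      by have := sqr_ge0 (sg - 1); rewrite sqrrB sg2; lra.
    have lc : l * c b <= eps / 4 by rewrite -lL ler_wpM2l // ltW.
    have : sg * (l * c b) <= 1 * (l * c b) by rewrite ler_wpM2r // mulr_ge0 // ltW.
    by rewrite mulrA; lra.
  rewrite ler_wpM2l ?ler0n // ler_expR; apply: le_trans expo.
  rewrite -/p -mulr_sumr sumc.
  have -> : \sum_b (sg * l * c b) ^+ 2 = l ^+ 2 * \sum_b c b ^+ 2.
    by rewrite mulr_sumr; apply: eq_bigr => b _; rewrite !exprMn sg2 mul1r.
  have : p * (2 * (l ^+ 2 * \sum_b c b ^+ 2)) <= p * (2 * (l ^+ 2 * (L%:R * A))).
    by rewrite ler_wpM2l ?(ltW p0) // ler_wpM2l // ler_wpM2l // sqr_ge0.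
  by rewrite mulrDr; lra.
have := bound 1 (expr1n _ _); have := bound (-1) (etrans (sqrrN 1) (expr1n _ _)).
set b1 := #|_|; set b2 := #|_| => h1 h2.
have hc : (#|[set S : {set J} | (#|S| == M) && deviates eps S W]| <= b1 + b2)%N.
  apply: leq_trans (leq_card_setU _ _).
  apply/subset_leq_card/subsetP => S; rewrite !inE => /andP[-> dv] /=.
  move: dv; rewrite /deviates negb_and -!leNgt -/p -/A edgesE -!mulr_sumr.
  rewrite ler_pdivrMr // ler_pdivlMr // => /orP[] h; apply/orP; [left|right].
    have := ler_wpM2l (ltW l0) h; rewrite mulN1r; lra.
  by have := ler_wpM2l (ltW l0) h; lra.
have : (#|[set S : {set J} | (#|S| == M) && deviates eps S W]|%:R : R) <= b1%:R + b2%:R.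
  by rewrite -natrD ler_nat.
by move=> h; lra.
Qed.

Lemma cycle_edges_sub (S : {set J}) (s : {perm 'I_n}) : (3 < n)%N ->
  (cycle_edges s \subset block_union S) = (blocks_hit blk s \subset S).
Proof.
move=> n4; apply/subsetP/subsetP => h x /imsetP[i _ ->].
  have := h (window s i); rewrite inE => /(_ _)/andP[]; last by [].
  by apply/imsetP; exists i.
rewrite -/(window s i) inE; apply/andP; split; last by apply: h; apply/imsetP; exists i.
have [a1 a2 _] := ordS_neq i n4; have [b1 _ _] := ordS_neq (ordS i) n4.
by apply/eqP/cards3; rewrite (inj_eq perm_inj) eq_sym.
Qed.

Definition ham_perms (S : {set J}) : nat :=
  #|[set s : {perm 'I_n} | cycle_edges s \subset block_union S]|.

Lemma sum_ham_perms : (3 < n)%N ->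
  (\sum_(S : {set J} | #|S| == M) ham_perms S =
   \sum_(s : {perm 'I_n}) #|[set S : {set J} | (#|S| == M) && (blocks_hit blk s \subset S)]|)%N.
Proof.
move=> n4; under [RHS]eq_bigr => s _ do rewrite -sum1dep_card big_mkcondr /=.
rewrite [RHS]exchange_big /=; apply: eq_bigr => S _.
rewrite /ham_perms -sum1dep_card big_mkcond; apply: eq_bigr => s _.
by rewrite cycle_edges_sub.
Qed.

Let p : R := j.+1%:R^-1.

(** An ordering meeting [d] blocks survives in at least a share [p ^ d / 2] of the choices, as
    [d <= n] and [2 n^2 <= M]. In the sum of the tangents at [n - t] the linear part is nonnegative,
    because at least [t] places are saved on average. *)
Lemma sum_ham_perms_ge (t : nat) : (3 < n)%N -> (2 * n ^ 2 <= M)%N ->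
  (n`! * t <= \sum_s #|saved blk s|)%N ->
  'C(#|J|, M)%:R / 2 * (n`!%:R * p ^+ (n - t)) <=
  (\sum_(S : {set J} | #|S| == M) ham_perms S)%:R.
Proof.
move=> n4 nM hs; rewrite sum_ham_perms // natr_sum.
have p01 : 0 <= p <= 1 by rewrite invr_ge0 ler0n invf_le1 ?ltr0n // ler1n.
have /andP[p0 p1] := p01.
set C : R := _ / 2; have C0 : 0 <= C by rewrite divr_ge0 ?ler0n.
apply: (@le_trans _ _ (\sum_s C * p ^+ #|blocks_hit blk s|)); last first.
  apply: ler_sum => s _.
  have dn : (#|blocks_hit blk s| <= n)%N := leq_trans (leq_addr _ _) (card_blocks_hit blk s).
  set d := #|_| in dn *.
  have dM : (d <= M)%N by nia.
  apply: (@le_trans _ _ 'C(#|J| - d, M - d)%:R); last by rewrite ler_nat card_supersets.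
  rewrite cardJ; apply: le_trans (bin_ratio R _ M0 dM) => //.
  rewrite /C cardJ mulrAC ler_wpM2l ?mulr_ge0 ?ler0n ?exprn_ge0 //.
  have : d%:R ^+ 2 / M%:R <= 1 / 2 :> R.
    rewrite ler_pdivrMr ?ltr0n // -natrX.
    have : ((2 * d ^ 2)%N%:R : R) <= M%:R.
      rewrite ler_nat; apply: leq_trans nM.
      by rewrite leq_mul2l leq_sqr.
    by rewrite natrM; lra.
  by lra.
rewrite -mulr_sumr ler_wpM2l //.
pose m := (n - t)%N.
apply: (@le_trans _ _ (\sum_(s : {perm 'I_n})
    p ^+ m * (1 + (m%:R - #|blocks_hit blk s|%:R) * (1 - p)))); last first.
  by apply: ler_sum => s _; apply: bernoulli_tangent.
rewrite -mulr_sumr mulrC ler_wpM2l ?exprn_ge0 // big_split /= sumr_const card_Sn.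
rewrite lerDl -mulr_suml mulr_ge0 ?subr_ge0 //.
apply: (@le_trans _ _ (\sum_(s : {perm 'I_n}) (#|saved blk s|%:R - t%:R))).
  by rewrite sumrB -natr_sum sumr_const card_Sn subr_ge0 -mulrnA ler_nat mulnC.
apply: ler_sum => s _.
have := card_blocks_hit blk s; rewrite -(ler_nat R) natrD.
have : n%:R <= m%:R + t%:R :> R by rewrite -natrD ler_nat /m; lia.
by lra.
Qed.

(** By averaging: if the claim fails, the good [S] contribute at most 1/8 and the others at most 1/4
    of [N * c], short of the required 1/2. *)
Lemma exists_blocks (eps : R) (t : nat) : (3 < n)%N -> (2 * n ^ 2 <= M)%N ->
  (n`! * t <= \sum_s #|saved blk s|)%N -> (t <= n)%N ->
  0 < eps <= 1 -> (0 < 'C(n./2, 3))%N ->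
  2 ^+ n * (2 * #|J|.+1%:R * expR (- (eps ^+ 2 / 8 * ('C(n./2, 3)%:R / L%:R))))
    <= p ^+ n / 4 ->
  exists S : {set J}, [/\ #|S| = M,
    forall W : {set 'I_n}, #|W| = n./2 -> ~~ deviates eps S W
    & n`!%:R * p ^+ (n - t) / 8 <= (ham_perms S)%:R].
Proof.
move=> n4 nM hs tn eps01 A0 small.
have p01 : 0 < p <= 1 by rewrite invr_gt0 ltr0n invf_le1 ?ltr0n // ler1n.
have /andP[p0 p1] := p01.
set c := n`!%:R * p ^+ (n - t).
pose good (S : {set J}) := [forall W : {set 'I_n}, (#|W| == n./2) ==> ~~ deviates eps S W].
have [/existsP[S /and3P[/eqP cS /forallP gS hS]]|no] := boolP [exists S : {set J},
    [&& #|S| == M, good S & c / 8 <= (ham_perms S)%:R]].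
  by exists S; split=> // W cW; have := gS W; rewrite cW eqxx.
exfalso.
have c0 : 0 < c by rewrite mulr_gt0 ?exprn_gt0 // ltr0n fact_gt0.
set N : R := 'C(#|J|, M)%:R.
have N0 : 0 < N by rewrite ltr0n bin_gt0 cardJ leq_pmull.
have := sum_ham_perms_ge n4 nM hs; rewrite -/c -/N natr_sum.
rewrite (bigID good) /=.
have h1 : \sum_(S : {set J} | (#|S| == M) && good S) (ham_perms S)%:R <= N * (c / 8).
  apply: (@le_trans _ _ (\sum_(S : {set J} | #|S| == M) (c / 8))).
    rewrite big_mkcondr; apply: ler_sum => S cS; case: ifP => gS; last first.
      by rewrite ltW // divr_gt0.
    have := no; rewrite negb_exists => /forallP/(_ S).
    by rewrite cS gS /= -ltNge => /ltW.
  rewrite sumr_const.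
  have -> : #|[pred S : {set J} | #|S| == M]| = 'C(#|J|, M).
    rewrite -cardsT -cards_draws; apply: eq_card => S; rewrite !inE.
    by rewrite subsetT.
  by rewrite -[leLHS]mulr_natl.
have h2 : \sum_(S : {set J} | (#|S| == M) && ~~ good S) (ham_perms S)%:R <= N * (c / 4).
  have hb : (\sum_(S : {set J} | (#|S| == M) && ~~ good S) ham_perms S <=
     \sum_(W : {set 'I_n} | #|W| == n./2)
        #|[set S : {set J} | (#|S| == M) && deviates eps S W]| * n`!)%N.
    under [leqRHS]eq_bigr => W _ do rewrite -sum_nat_const big_mkcond.
    rewrite exchange_big /= big_mkcond; apply: leq_sum => S _.
    case: ifP => // /andP[cS]; rewrite negb_forall => /existsP[W].
    rewrite negb_imply negbK => /andP[cW dW].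
    rewrite (bigD1 W) //= inE cS dW /=; apply: leq_trans (leq_addr _ _).
    by rewrite -card_Sn /ham_perms max_card.
  rewrite -(ler_nat R) in hb; rewrite -natr_sum; apply: le_trans hb _.
  rewrite natr_sum.
  set X := expR _ in small.
  apply: (@le_trans _ _ (\sum_(W : {set 'I_n}) (2 * (#|J|.+1 * 'C(#|J|, M))%:R * X * n`!%:R))).
    rewrite big_mkcond; apply: ler_sum => W _; case: ifP => [/eqP cW|_]; last first.
      by rewrite !mulr_ge0 ?ler0n ?expR_ge0.
    rewrite natrM ler_wpM2r ?ler0n //.
    have := @card_deviates eps W eps01; rewrite cW => /(_ A0) h.
    exact: h.
  rewrite sumr_const.
  have -> : #|{set 'I_n}| = (2 ^ n)%N.
    by rewrite -cardsT -powersetT card_powerset cardsT card_ord.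
  rewrite -[leLHS]mulr_natl natrX natrM -/N.
  have -> : 2 ^+ n * (2 * (#|J|.+1%:R * N) * X * n`!%:R) =
    N * n`!%:R * (2 ^+ n * (2 * #|J|.+1%:R * X)) by ring.
  have -> : N * (c / 4) = N * n`!%:R * (p ^+ (n - t) / 4) by rewrite /c; ring.
  rewrite ler_wpM2l ?mulr_ge0 ?ler0n ?(ltW N0) //; apply: le_trans small _.
  rewrite ler_wpM2r // ?invr_ge0 //.
  by rewrite ler_wiXn2l // ?(ltW p0) // leq_subr.
have : 0 < N * c by rewrite mulr_gt0.
by lra.
Qed.
End RandomBlocks.

(** * The lower bound *)

(** The exponent is at least [c q^9 / 64], while the factors to beat total at most
    [(j + 1) ^ (4 n) <= exp (4 n (j + 1))]. With [n <= 2 q^4] this leads to the constant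
    [512 = 64 * 8]. *)
Lemma tail_bound (R : realType) (c : R) (j q B L : nat) :
  (40 <= q)%N -> (0 < j)%N -> (0 < L)%N -> 0 < c ->
  let n := (q ^ 4 + 1)%N in
  (B <= 2 ^ n)%N ->
  (q ^ 9 * L <= 64 * 'C(n./2, 3))%N ->
  512 * j.+1%:R <= c * q%:R ->
  2 ^+ n * (2 * B.+1%:R * expR (- (c * ('C(n./2, 3)%:R / L%:R))))
    <= j.+1%:R^-1 ^+ n / 4.
Proof.
move=> q40 j0 L0 c0 n Bn hA hc.
have L0R : 0 < L%:R :> R by rewrite ltr0n.
set A : R := _ / L%:R.
have hA' : (q ^ 9)%:R / 64 <= A.
  rewrite /A ler_pdivlMr // mulrAC ler_pdivrMr // -!natrM ler_nat.
  by rewrite [leqRHS]mulnC.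
have k0 : 0 < j.+1%:R :> R by rewrite ltr0n.
rewrite expRN exprVn.
have E0 := expR_gt0 (c * A).
set X : R := j.+1%:R ^+ n; have X0 : 0 < X by rewrite exprn_gt0.
suff main : 4 * (2 ^+ n * (2 * B.+1%:R)) * X <= expR (c * A).
  rewrite mulrA ler_pdivrMr //.
  have -> : X^-1 / 4 * expR (c * A) = expR (c * A) / (4 * X).
    by field; rewrite lt0r_neq0.
  rewrite ler_pdivlMr ?mulr_gt0 //; apply: le_trans main.
  by rewrite le_eqVlt; apply/orP; left; apply/eqP; ring.
rewrite /X.
have n4 : (4 <= n)%N by rewrite /n addn1 ltnS (@leq_trans (40 ^ 4)) ?leq_exp2r.
apply: (@le_trans _ _ ((j.+1 ^ (4 * n))%N%:R)).
  have -> : (4 * (2 ^+ n * (2 * B.+1%:R)) * j.+1%:R ^+ n : R) =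
      (8 * 2 ^ n * B.+1 * j.+1 ^ n)%N%:R.
    by rewrite !natrM !natrX; ring.
  rewrite ler_nat.
  apply: (@leq_trans (j.+1 ^ 4 * j.+1 ^ n * j.+1 ^ n * j.+1 ^ n)).
    have hB : (B.+1 <= 2 * 2 ^ n)%N by have := expn_gt0 2 n; lia.
    have h2 : (2 ^ n <= j.+1 ^ n)%N by rewrite leq_exp2r // (leq_trans _ n4).
    have h4 : (2 ^ 4 <= j.+1 ^ 4)%N by rewrite leq_exp2r.
    rewrite leq_mul2r; apply/orP; right.
    apply: (@leq_trans (8 * 2 ^ n * (2 * 2 ^ n))); first by rewrite leq_mul2l hB orbT.
    have -> : (8 * 2 ^ n * (2 * 2 ^ n) = 2 ^ 4 * 2 ^ n * 2 ^ n)%N by ring.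
    by do 2?apply: leq_mul => //.
  by rewrite -!expnD leq_exp2l //; lia.
rewrite natrX.
apply: (@le_trans _ _ (expR j.+1%:R ^+ (4 * n))).
  rewrite lerXn2r ?nnegrE ?expR_ge0 ?ler0n //.
  by have := expR_ge1Dx (j.+1%:R : R); lra.
rewrite -expRM_natl ler_expR.
apply: (@le_trans _ _ (c * ((q ^ 9)%:R / 64))); last by rewrite ler_wpM2l // ltW.
have hn : (n <= 2 * q ^ 4)%N by rewrite /n; have := expn_gt0 q 4; lia.
apply: (@le_trans _ _ ((4 * (2 * q ^ 4))%N%:R * j.+1%:R)).
  by rewrite ler_wpM2r ?ler0n // ler_nat leq_mul2l hn.
have h1 : (q ^ 4 * q)%N%:R <= (q ^ 9)%N%:R :> R.
  by rewrite ler_nat -expnSr leq_exp2l //; lia.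
have h2 : (q ^ 4)%N%:R * (512 * j.+1%:R) <= (q ^ 4)%N%:R * (c * q%:R).
  by rewrite ler_wpM2l ?ler0n.
have h3 : c * (q ^ 4 * q)%N%:R <= c * (q ^ 9)%N%:R by rewrite ler_wpM2l // ltW.
rewrite !natrM in h3 *; lra.
Qed.

Lemma block_union_quasi_random (R : realType) (n L j M : nat) (J : finType)
    (blk : {set 'I_n} -> J) (eps eps' : R) (S : {set J}) :
  (forall b, #|[set T : {set 'I_n} | (#|T| == 3) && (blk T == b)]| = L) ->
  'C(n, 3) = (j.+1 * M * L)%N -> #|S| = M -> eps' <= eps ->
  (forall W : {set 'I_n}, #|W| = n./2 -> ~~ deviates j blk eps' S W) ->
  is_3graph (block_union blk S) && quasi_random eps j.+1%:R^-1 (block_union blk S).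
Proof.
move=> cardL cn cS ee dev; apply/and3P; split.
- by apply/forall_inP => T; rewrite inE => /andP[].
- rewrite /has_density (card_block_union cardL) cS cn -mulnA [X in _ == _ * X]natrM.
  by rewrite mulKf // pnatr_eq0.
apply/forallP => W; apply/implyP => /eqP cW.
have := dev W cW; rewrite negbK /edges_in => /andP[h1 h2].
by apply/andP; split; [apply: le_lt_trans h1|apply: lt_le_trans h2 _];
   rewrite lerD2l ?lerN2.
Qed.

Lemma H3_ge (R : realType) (eps p : R) (n : nat) (E : {set {set 'I_n}}) :
  (3 < n)%N -> is_3graph E && quasi_random eps p E ->
  (#|[set s : {perm 'I_n} | cycle_edges s \subset E]| <= H3 n p eps * n ^ 3)%N.
Proof.
move=> n4 hE; apply: leq_trans (card_ham_perms E n4) _.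
by rewrite leq_mul2r /H3 (@leq_bigmax_cond _ _ (@H n)) ?orbT.
Qed.

Lemma powR_fourth_root (R : realType) (q : nat) : (0 < q)%N ->
  powR ((q ^ 4 + 1)%N%:R : R) 4^-1 <= (2 * q)%N%:R.
Proof.
move=> q0.
have -> : (2 * q)%N%:R = powR (((2 * q) ^ 4)%N%:R : R) 4^-1.
  rewrite natrX -powR_mulrn ?ler0n // -powRrM mulfV ?pnatr_eq0 // powRr1 //.
apply: ge0_ler_powR; rewrite ?nnegrE ?ler0n ?invr_ge0 // ler_nat.
by rewrite expnMn; have := expn_gt0 q 4; rewrite q0 /=; lia.
Qed.

Theorem theorem4 (R : realType) (eps p : R) :
  0 < eps -> 0 < p < 1 -> (exists k : nat, p^-1 = k%:R) ->
  exists2 c : R, 0 < c &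
  exists Q : nat, forall q : nat, (Q <= q)%N -> prime_power q ->
    (exists m : nat, p * ((q ^ 3 * (q ^ 6 + q ^ 4 + q ^ 2 + 1))%N)%:R = m%:R) ->
    let n := (q ^ 4 + 1)%N in
    powR (p^-1) (c * powR (n%:R) (4^-1)) <= (H3 n p eps)%:R / Eexp n p.
Proof.
move=> eps0 /andP[p0 p1] [k pk]; exists 1 => //.
have [j j0 {k pk} pj] : exists2 j, (0 < j)%N & p = j.+1%:R^-1.
  case: k pk => [|[|j]] pk.
  - by move: p0; rewrite -invr_gt0 pk ltxx.
  - by move: p1; rewrite -[p]invrK pk invr1 ltxx.
  - by exists j.+1; rewrite // -pk invrK.
(* [card_deviates] wants a deviation of at most 1; lowering it only strengthens quasi-randomness. *)
pose eps' := Num.min eps 1.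
have eps'01 : 0 < eps' <= 1 by rewrite lt_min eps0 ltr01 ge_min lexx orbT.
have eps'0 : 0 < eps' by case/andP: eps'01.
pose c := eps' ^+ 2 / 8.
have c0 : 0 < c by rewrite divr_gt0 ?exprn_gt0.
(* 40 is for [block_size_bounds], [8 * j.+1] for [2 n^2 <= M], and the last bound for
   [tail_bound]. *)
exists (maxn (maxn 40 (8 * j.+1)) (Num.bound (512 * j.+1%:R / c))).
move=> q; rewrite !geq_max => /andP[/andP[q40 qj] qc] _ [M hM].
lazy zeta; set n := (q ^ 4 + 1)%N.
set B := (q ^ 3 * _)%N in hM.
have eB : B = (j.+1 * M)%N.
  apply/eqP; rewrite -(eqr_nat R) natrM -hM pj mulrA mulfV ?mul1r //.
  by rewrite pnatr_eq0.
have cq : 512 * j.+1%:R <= c * q%:R.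
  rewrite [leRHS]mulrC -ler_pdivrMr //; apply: ltW.
  apply: (@lt_le_trans _ _ (Num.bound (512 * j.+1%:R / c))%:R).
    by apply: archi_boundP; apply: divr_ge0; [rewrite mulr_ge0 ?ler0n | exact: ltW].
  by rewrite ler_nat.
have q0 : (0 < q)%N by apply: leq_trans q40.
have [L1 L6 L2] := block_size_bounds q40.
have cn : 'C(n, 3) = (B * 'C(q + 1, 3))%N := design_count q0.
set L := 'C(q + 1, 3) in L1 L6 L2 cn.
have L0 : (0 < L)%N by apply: leq_trans L1.
have B9 : (q ^ 9 <= B)%N.
  by rewrite [(q ^ 9)%N](expnD q 3 6) leq_mul2l -!addnA leq_addr orbT.
have B0 : (0 < B)%N by apply: leq_trans B9; rewrite expn_gt0 q0.
have n4 : (4 <= n)%N by rewrite /n addn1 ltnS (@leq_trans (40 ^ 4)) ?leq_exp2r.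
have q44 : (40 <= q ^ 4)%N by rewrite (leq_trans q40) // -{1}[q]expn1 leq_exp2l //; lia.
have nM : (2 * n ^ 2 <= M)%N.
  (* [j.+1 * M = B] is at least [q^9], while [2 n^2 <= 8 q^8]. *)
  rewrite -(@leq_pmul2l j.+1) // -eB; apply: leq_trans B9.
  have hn : (n <= 2 * q ^ 4)%N by rewrite /n; lia.
  apply: (@leq_trans (j.+1 * (2 * (2 * q ^ 4) ^ 2))).
    by rewrite !leq_mul2l leq_sqr hn orbT.
  have -> : (j.+1 * (2 * (2 * q ^ 4) ^ 2) = 8 * j.+1 * q ^ 8)%N by ring.
  by rewrite expnS leq_mul2r qj orbT.
have M0 : (0 < M)%N by apply: leq_trans nM; rewrite muln_gt0 expn_gt0 (leq_trans _ n4).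
have hA : (q ^ 9 * L <= 64 * 'C(n./2, 3))%N.
  apply: half_triples_bound; first exact: leq_trans q40.
  by rewrite [(q ^ 12)%N](expnD q 9 3) leq_mul2l L6 orbT.
have A0 : (0 < 'C(n./2, 3))%N.
  by move: hA; case: 'C(n./2, 3) => //; rewrite muln0 leqn0 muln_eq0 expn_eq0; lia.
have [blk [U [cardL hfan hnofan]]] := exists_triple_blocks L0 B0 cn.
(* Of these saved places, [2 * q] give the target, since [n^(1/4) <= 2 q], and [9 * q] pay for the
   polynomial loss; [18 * 11 = 198] is the constant of [block_size_bounds]. *)
pose t := (11 * q)%N.
have tn : (t <= n)%N.
  have : (40 * q <= q ^ 3 * q)%N.
    by rewrite leq_mul2r (leq_trans q40) ?orbT // -{1}[q]expn1 leq_exp2l //; lia.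
  by rewrite -expnSr /t /n; lia.
have hs : (n`! * t <= \sum_s #|saved blk s|)%N.
  rewrite -(@leq_pmul2l 18) //.
  apply: leq_trans (sum_card_saved (U := U) _ hfan hnofan _ n4).
  - by rewrite mulnCA leq_mul2l /t; apply/orP; right; lia.
  - by move=> T cT; apply: cardL.
  - by rewrite /n; lia.
have cJ : #|'I_B| = (j.+1 * M)%N by rewrite card_ord.
have Bn : (B <= 2 ^ n)%N.
  by apply: leq_trans (bin_le_exp2 n 3); rewrite cn leq_pmulr.
have small := tail_bound q40 j0 L0 c0 Bn hA cq; rewrite -/n in small.
have [|S [cS dS hamS]] := exists_blocks cardL cJ j0 L0 M0 n4 nM hs tn eps'01 A0.
  by rewrite card_ord.
have hE := block_union_quasi_random cardL (etrans cn (congr1 (muln^~ L) eB)) cS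
  (_ : eps' <= eps) dS.
have {hE} := H3_ge n4 (hE _); rewrite -pj -/(ham_perms _ _) => /(_ _) hH.
have {hH} hH : n`!%:R * p ^+ (n - t) / 8 <= (H3 n p eps)%:R * n%:R ^+ 3 :> R.
  rewrite pj; apply: le_trans hamS _; rewrite -natrX -natrM ler_nat -pj.
  by apply: hH; rewrite ge_min lexx.
have Eexp0 : 0 < Eexp n p.
  by rewrite /Eexp !mulr_gt0 ?invr_gt0 ?exprn_gt0 // ltr0n fact_gt0.
rewrite ler_pdivlMr // mul1r.
have pinv : p^-1 = j.+1%:R by rewrite pj invrK.
apply: (@le_trans _ _ (j.+1%:R ^+ (2 * q) * Eexp n p)).
  rewrite ler_wpM2r ?(ltW Eexp0) // pinv -powR_mulrn ?ler0n //.
  by rewrite ler_powR ?ler1n // powR_fourth_root.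
have n0 : 0 < n%:R :> R by rewrite ltr0n (leq_trans _ n4).
have n30 : 0 < n%:R ^+ 3 :> R by rewrite exprn_gt0.
rewrite -(ler_pM2r n30); apply: le_trans hH.
have -> : p ^+ (n - t) = p ^+ n * j.+1%:R ^+ t.
  rewrite -{2}(subnK tn) exprD -mulrA -exprMn -pinv mulfV ?lt0r_neq0 //.
  by rewrite expr1n mulr1.
(* This absorbs one factor of [n ^ 3], leaving the [n ^ 2] of [gain_bound], whose 4 is the quotient
   of the denominators 8 and 2. *)
have -> : n`! = (n * n.-1`!)%N by rewrite /n addn1 factS.
have := @gain_bound j.+1 q j0 q40; rewrite -/n -/t -(ler_nat R) !natrM !natrX.
set K := _ ^+ (2 * q); set K' := _ ^+ t => hg; rewrite /Eexp.
set F := n.-1`!%:R.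
have -> : K * (p ^+ n * F / 2) * n%:R ^+ 3 = (p ^+ n * F * n%:R / 8) * (4 * n%:R ^+ 2 * K).
  by field.
have -> : n%:R * F * (p ^+ n * K') / 8 = (p ^+ n * F * n%:R / 8) * K' by ring.
by rewrite ler_wpM2l // !mulr_ge0 ?ler0n ?exprn_ge0 ?invr_ge0 // ltW.
Qed.
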